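(* Fix a system $\mathbf F=\sum_{i=1}^l\mathbf F_i\delta_{M_i}$ of pointed forces in the plane $\mathbb{R}^2$ in equilibrium, i.e. $\sum_i\mathbf F_i=0$ and $\sum_i\mathbf F_i\wedge M_i=0$. Suppose a minimizer exists for this system, that is, a spring system balancing $\mathbf F$ whose total mass is minimal among all spring systems balancing $\mathbf F$. Then at any point $x$ outside the system ($x\notin\{M_1,\dots,M_l\}$), if there are finitely many springs of the minimizer intersecting at $x$, the following hold: (1) the sum of the boundary forces at $x$ of these springs is zero; (2) the angle at $x$ between a stretched spring and a compressed spring is $90^\circ$.
   Context: A spring system is a finite collection of segments $[a,b]$ in $\mathbb{R}^2$, $a\neq b$, each with a nonzero real coefficient $\lambda$. Put $\mathrm{Beam}([a,b])=(\delta_b-\delta_a)\frac{b-a}{|b-a|}$, an $\mathbb{R}^2$-valued measure, where $\delta_a$ is the Dirac mass at $a$. The spring system balances $\mathbf F$ if $\mathbf F=\sum\lambda\,\mathrm{Beam}([a,b])$, the sum running over its springs. A spring is stretched if $\lambda>0$ and compressed if $\lambda<0$. The total mass is the sum over the springs of $|\lambda|\,|b-a|$ (spring constant times length). The springs intersecting at $x$ are the springs having $x$ as an endpoint, where a spring containing $x$ in its interior is regarded as two springs with the same coefficient, obtained by subdividing it at $x$. The boundary force at $x$ of a spring $[x,y]$ with coefficient $\lambda$ is $\lambda\frac{x-y}{|x-y|}$, and the angle between springs $[x,y]$ and $[x,z]$ is the angle between $y-x$ and $z-x$. *)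

(* Defs.v *)
From mathcomp Require Import all_boot all_order all_algebra.
From mathcomp Require Import all_classical all_reals all_analysis.

Set Implicit Arguments.
Unset Strict Implicit.
Unset Printing Implicit Defensive.

Import Order.TTheory GRing.Theory Num.Theory.
Import numFieldNormedType.Exports.

Local Open Scope classical_set_scope.
Local Open Scope ring_scope.

Notation plane R := 'rV[R]_2.

(* The norm that the library puts on row vectors is the sup norm, hence the
   Euclidean structure is defined here. *)
Definition dot (R : realType) (u v : plane R) : R := \sum_(i < 2) u 0 i * v 0 i.

Definition enorm (R : realType) (u : plane R) : R := Num.sqrt (dot u u).

Definition normalize (R : realType) (u : plane R) : plane R :=
  (enorm u)^-1 *: u.

Definition wedge (R : realType) (u v : plane R) : R :=
  u 0 ord0 * v 0 ord_max - u 0 ord_max * v 0 ord0.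

Definition angle (R : realType) (u v : plane R) : R :=
  acos (dot u v / (enorm u * enorm v)).

(* The plane with its Borel sigma-algebra. *)
Definition borel_plane (R : realType) := g_sigma_algebraType (@open (plane R)).

Definition vmeasure (R : realType) := set (borel_plane R) -> plane R.

Definition eq_vmeasure (R : realType) (mu nu : vmeasure R) : Prop :=
  forall A : set (borel_plane R), measurable A -> mu A = nu A.

(* [dirac] is valued in the extended reals; its values 0 and 1 are finite. *)
Definition point_mass (R : realType) (a : plane R) (A : set (borel_plane R)) :
    R := fine (dirac (a : borel_plane R) A).

Definition force_system (R : realType) (l : nat) (F M : 'I_l -> plane R) :
    vmeasure R := fun A => \sum_(i < l) point_mass (M i) A *: F i.

Definition equilibrium (R : realType) (l : nat) (F M : 'I_l -> plane R) : Prop :=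
  \sum_(i < l) F i = 0 /\ \sum_(i < l) wedge (F i) (M i) = 0.

(* (a, b, lambda) stands for the segment [a, b] with coefficient lambda;
   exchanging a and b changes neither its beam nor its boundary forces. *)
Definition spring (R : realType) := (plane R * plane R * R)%type.

Definition end1 (R : realType) (s : spring R) : plane R := s.1.1.
Definition end2 (R : realType) (s : spring R) : plane R := s.1.2.
Definition coef (R : realType) (s : spring R) : R := s.2.

Definition is_spring (R : realType) (s : spring R) : bool :=
  (end1 s != end2 s) && (coef s != 0).

Definition is_spring_system (R : realType) (S : seq (spring R)) : bool :=
  all (@is_spring R) S.

Definition beam (R : realType) (a b : plane R) : vmeasure R :=
  fun A => (point_mass b A - point_mass a A) *: normalize (b - a).

Definition balances (R : realType) (S : seq (spring R)) (mu : vmeasure R) : Prop :=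
  eq_vmeasure mu (fun A => \sum_(s <- S) coef s *: beam (end1 s) (end2 s) A).

Definition total_mass (R : realType) (S : seq (spring R)) : R :=
  \sum_(s <- S) `|coef s| * enorm (end2 s - end1 s).

Definition minimizer (R : realType) (mu : vmeasure R) (S : seq (spring R)) : Prop :=
  [/\ is_spring_system S, balances S mu &
      forall T : seq (spring R), is_spring_system T -> balances T mu ->
        total_mass S <= total_mass T].

Definition stretched (R : realType) (s : spring R) : bool := 0 < coef s.
Definition compressed (R : realType) (s : spring R) : bool := coef s < 0.

(* For a != b: x lies in the relative interior of [a, b]. *)
Definition in_interior (R : realType) (x a b : plane R) : Prop :=
  exists t : R, 0 < t < 1 /\ x = (1 - t) *: a + t *: b.

Definition subdivide (R : realType) (x : plane R) (s : spring R) :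
    seq (spring R) :=
  if `[< in_interior x (end1 s) (end2 s) >]
  then [:: (end1 s, x, coef s); (x, end2 s, coef s)]
  else [:: s].

Definition springs_at (R : realType) (S : seq (spring R)) (x : plane R) :
    seq (spring R) :=
  [seq s <- flatten [seq subdivide x s | s <- S] |
     (end1 s == x) || (end2 s == x)].

(* For a spring s one of whose endpoints is x: the other endpoint. *)
Definition far_end (R : realType) (x : plane R) (s : spring R) : plane R :=
  if end1 s == x then end2 s else end1 s.

Definition boundary_force (R : realType) (x : plane R) (s : spring R) : plane R :=
  coef s *: normalize (x - far_end x s).

Definition spring_angle (R : realType) (x : plane R) (s t : spring R) : R :=
  angle (far_end x s - x) (far_end x t - x).

(* Main.v *)
Require Import Defs.
From mathcomp Require Import all_boot all_order all_algebra.
From mathcomp Require Import all_classical all_reals all_analysis.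
From mathcomp Require Import ring lra.

Set Implicit Arguments.
Unset Strict Implicit.
Unset Printing Implicit Defensive.

Import Order.TTheory GRing.Theory Num.Theory.
Import numFieldNormedType.Exports.

Local Open Scope classical_set_scope.
Local Open Scope ring_scope.

(** Subdividing at x changes neither the measure nor the total mass, so every
    spring of the minimizer that meets x may be assumed to end there.  Testing
    the balance on the singleton of x, which carries no external force, then
    gives the first claim ([load_boundary_force]).

    For the second claim, the heart of the matter is that a stretched and a
    compressed spring of a minimizer can never form an acute angle
    ([minimizer_obtuse]).  Let e and f be their unit directions and put
    dot e f = 2 t with t > 0.  In units of a small length r, add a self-stress
    on the seven points 0, t e, e, t f, f, w and w', where
    w = t e - t^2 (f - 2 t e) lies just off the first spring, and w' is its
    mirror image off the second.  Two cross bars join e to t f and t e to f;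
    they pull e and t e sideways in opposite senses, and the sideways forces
    are passed on to 0 through w by three thin bars.  What remains acts along
    the two springs, and unloads both of them.  In terms of the strength k of
    the self-stress, the springs lose k r (t - t^4) each, while the added bars
    cost only 2 k r (t - t^4 - 8 t^6) in all: the total mass drops by
    16 k r t^6 ([acute_pair_improvable]).

    Hence all stretched-compressed angles are at least right.  By the balance
    at x, the sum P of coefficient times direction over the stretched springs
    is opposite to the corresponding sum over the compressed ones.  Expanding
    the square of P as minus the product of the two sums gives only nonpositive
    terms, so P = 0; pairing P with the direction of a compressed spring then
    shows that every one of these inner products vanishes
    ([balanced_obtuse_orthogonal]). *)

(** * Euclidean geometry of the plane *)

Lemma dotE (R : realType) (u v : plane R) :
  dot u v = u 0 ord0 * v 0 ord0 + u 0 ord_max * v 0 ord_max.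
Proof.
rewrite /dot big_ord_recl big_ord1.
by have -> : lift ord0 ord0 = ord_max :> 'I_2 by exact: val_inj.
Qed.

Lemma dotC (R : realType) (u v : plane R) : dot u v = dot v u.
Proof. by rewrite !dotE; ring. Qed.

Lemma dotDl (R : realType) (u v w : plane R) : dot (u + v) w = dot u w + dot v w.
Proof. by rewrite !dotE !mxE; ring. Qed.

Lemma dotZl (R : realType) (a : R) (u v : plane R) : dot (a *: u) v = a * dot u v.
Proof. by rewrite !dotE !mxE; ring. Qed.

Lemma dotDr (R : realType) (u v w : plane R) : dot u (v + w) = dot u v + dot u w.
Proof. by rewrite dotC dotDl !(dotC u). Qed.

Lemma dotZr (R : realType) (a : R) (u v : plane R) : dot u (a *: v) = a * dot u v.
Proof. by rewrite dotC dotZl dotC. Qed.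

Lemma dot_comb (R : realType) (e f : plane R) (a b : R) :
  dot e e = 1 -> dot f f = 1 ->
  dot (a *: e + b *: f) (a *: e + b *: f) = a ^+ 2 + b ^+ 2 + 2 * a * b * dot e f.
Proof.
move=> e1 f1; rewrite !(dotDl, dotDr, dotZl, dotZr) e1 f1 (dotC f); ring.
Qed.

Lemma dot_sumr (R : realType) (I : Type) (r : seq I) (P : pred I)
    (G : I -> plane R) (u : plane R) :
  dot u (\sum_(i <- r | P i) G i) = \sum_(i <- r | P i) dot u (G i).
Proof.
apply: (big_morph (dot u)) => [v w|]; first exact: dotDr.
by rewrite -(scale0r u) dotZr mul0r.
Qed.

Lemma dot_ge0 (R : realType) (u : plane R) : 0 <= dot u u.
Proof. by rewrite dotE addr_ge0 // -expr2 sqr_ge0. Qed.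

Lemma dot_eq0 (R : realType) (u : plane R) : (dot u u == 0) = (u == 0).
Proof.
apply/idP/eqP => [|->]; last by rewrite -(scale0r 0) dotZl mul0r.
rewrite dotE -!expr2 paddr_eq0 ?sqr_ge0 // !sqrf_eq0 => /andP[/eqP u0 /eqP u1].
apply/rowP => i; rewrite mxE.
by case: (unliftP ord_max i) => [j ->|->//]; rewrite (ord1 j) -u0; congr (u _ _); exact: val_inj.
Qed.

Lemma enorm_ge0 (R : realType) (u : plane R) : 0 <= enorm u.
Proof. exact: sqrtr_ge0. Qed.

Lemma enorm_sqr (R : realType) (u : plane R) : enorm u ^+ 2 = dot u u.
Proof. by rewrite sqr_sqrtr // dot_ge0. Qed.

Lemma enorm_eq0 (R : realType) (u : plane R) : (enorm u == 0) = (u == 0).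
Proof. by rewrite -sqrf_eq0 enorm_sqr dot_eq0. Qed.

Lemma enorm_gt0 (R : realType) (u : plane R) : (0 < enorm u) = (u != 0).
Proof. by rewrite lt_def enorm_ge0 andbT enorm_eq0. Qed.

Lemma enormZ (R : realType) (a : R) (u : plane R) :
  enorm (a *: u) = `|a| * enorm u.
Proof.
by rewrite /enorm dotZl dotZr mulrA -expr2 sqrtrM ?sqr_ge0 // sqrtr_sqr.
Qed.

Lemma enorm_normalize (R : realType) (u : plane R) : enorm u *: normalize u = u.
Proof.
have [->|u0] := eqVneq u 0; first by rewrite /normalize !scaler0.
by rewrite scalerA mulfV ?scale1r // enorm_eq0.
Qed.

Lemma normalizeZ (R : realType) (a : R) (u : plane R) :
  0 < a -> normalize (a *: u) = normalize u.
Proof.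
move=> a0; rewrite /normalize enormZ gtr0_norm // invfM scalerA mulrAC.
by rewrite mulVf ?mul1r ?gt_eqF.
Qed.

Lemma normalizeB (R : realType) (u v : plane R) :
  normalize (u - v) = - normalize (v - u).
Proof.
by rewrite /normalize -opprB -scaleN1r enormZ normrN1 mul1r scaleN1r scalerN.
Qed.

Lemma dot_normalize (R : realType) (u : plane R) :
  u != 0 -> dot (normalize u) (normalize u) = 1.
Proof.
by move=> u0; rewrite dotZl dotZr -enorm_sqr mulrA -invfM mulVf // sqrf_eq0 enorm_eq0.
Qed.

(** * Loads of spring lists *)

(** The measure that a list of springs balances.  It is studied for arbitrary
    lists: null coefficients and segments reduced to a point contribute
    nothing, and a competitor may contain them. *)
Definition load (R : realType) (S : seq (spring R)) : vmeasure R :=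
  fun A => \sum_(s <- S) coef s *: beam (end1 s) (end2 s) A.

Lemma load_cat (R : realType) (S T : seq (spring R)) A :
  load (S ++ T) A = load S A + load T A.
Proof. exact: big_cat. Qed.

Lemma total_mass_cat (R : realType) (S T : seq (spring R)) :
  total_mass (S ++ T) = total_mass S + total_mass T.
Proof. exact: big_cat. Qed.

Lemma load_cons (R : realType) s (S : seq (spring R)) A :
  load (s :: S) A = load [:: s] A + load S A.
Proof. exact: (load_cat [:: s]). Qed.

Lemma total_mass_cons (R : realType) s (S : seq (spring R)) :
  total_mass (s :: S) = total_mass [:: s] + total_mass S.
Proof. exact: (total_mass_cat [:: s]). Qed.

Lemma load_filter (R : realType) (S : seq (spring R)) A :
  load [seq s <- S | is_spring s] A = load S A.
Proof.
rewrite /load big_filter [RHS](bigID (@is_spring R)) /=.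
rewrite [X in _ + X]big1 ?addr0 // => s; rewrite /is_spring negb_and !negbK.
case/orP=> /eqP h; last by rewrite h scale0r.
by rewrite /beam h subrr scale0r scaler0.
Qed.

Lemma total_mass_filter (R : realType) (S : seq (spring R)) :
  total_mass [seq s <- S | is_spring s] = total_mass S.
Proof.
rewrite /total_mass big_filter [RHS](bigID (@is_spring R)) /=.
rewrite [X in _ + X]big1 ?addr0 // => s; rewrite /is_spring negb_and !negbK.
case/orP=> /eqP h; last by rewrite h normr0 mul0r.
by rewrite h subrr -(scale0r 0) enormZ normr0 mul0r mulr0.
Qed.

(** Discarding the degenerate members of a list changes neither load nor mass,
    so a minimizer also beats lists that are not spring systems. *)
Lemma minimizer_le (R : realType) (mu : vmeasure R) (S T : seq (spring R)) :
  minimizer mu S -> (forall A, load T A = load S A) ->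
  total_mass S <= total_mass T.
Proof.
case=> _ balS minS eqTS; rewrite -(total_mass_filter T); apply: minS.
  exact: filter_all.
by move=> A mA; rewrite (balS A mA) -[RHS]/(load _ A) load_filter eqTS.
Qed.

(** * Subdivision *)

Lemma in_interiorP (R : realType) (x a b : plane R) : in_interior x a b ->
  exists t : R, [/\ 0 < t, 0 < 1 - t, x - a = t *: (b - a)
    & b - x = (1 - t) *: (b - a)].
Proof.
case=> t [/andP[t0 t1] ->]; exists t; split; rewrite ?subr_gt0 //.
  by apply/rowP => i; rewrite !mxE; ring.
by apply/rowP => i; rewrite !mxE; ring.
Qed.

Lemma load_subdivide (R : realType) (x : plane R) (s : spring R) A :
  load (subdivide x s) A = load [:: s] A.
Proof.
rewrite /subdivide; case: asboolP => // /in_interiorP[t [t0 t1 xa bx]].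
rewrite /load !big_cons !big_nil !addr0 /beam /end1 /end2 /coef /= -/(end1 s) -/(end2 s).
rewrite xa bx !normalizeZ // -scalerDr -scalerDl.
by rewrite addrC addrA subrK.
Qed.

Lemma total_mass_subdivide (R : realType) (x : plane R) (s : spring R) :
  total_mass (subdivide x s) = total_mass [:: s].
Proof.
rewrite /subdivide; case: asboolP => // /in_interiorP[t [t0 t1 xa bx]].
rewrite /total_mass !big_cons !big_nil !addr0 /end1 /end2 /coef /= -/(end1 s) -/(end2 s).
by rewrite xa bx !enormZ (gtr0_norm t0) (gtr0_norm t1); ring.
Qed.

Lemma subdivide_spring (R : realType) (x : plane R) (s : spring R) :
  is_spring s -> is_spring_system (subdivide x s).
Proof.
rewrite /subdivide => ss; case: asboolP => [/in_interiorP[t [t0 t1 xa bx]]|_]; last first.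
  by rewrite /is_spring_system /= ss.
case/andP: (ss) => ab c0.
have ba0 : end2 s - end1 s != 0 by rewrite subr_eq0 eq_sym.
rewrite /is_spring_system /is_spring /end1 /end2 /coef /= -/(end1 s) -/(end2 s) -/(coef s) c0 !andbT.
rewrite !(eq_sym _ x) -(subr_eq0 x (end1 s)) xa (eq_sym x) -(subr_eq0 (end2 s) x) bx.
by rewrite !scaler_eq0 !negb_or ba0 !gt_eqF.
Qed.

(** The list of which [springs_at S x] keeps the members ending at x. *)
Definition subdivision (R : realType) (x : plane R) (S : seq (spring R)) :=
  flatten [seq subdivide x s | s <- S].

Lemma load_subdivision (R : realType) (x : plane R) (S : seq (spring R)) A :
  load (subdivision x S) A = load S A.
Proof.
elim: S => //= s S IH.
by rewrite /subdivision /= load_cat load_cons -IH load_subdivide.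
Qed.

Lemma minimizer_subdivision (R : realType) (mu : vmeasure R) (x : plane R)
    (S : seq (spring R)) :
  minimizer mu S -> minimizer mu (subdivision x S).
Proof.
case=> sysS balS minS; split.
- elim: S sysS {balS minS} => //= s S IH /andP[ss sS].
  rewrite /subdivision /= /is_spring_system all_cat.
  by apply/andP; split; [exact: subdivide_spring | exact: IH].
- by move=> A mA; rewrite (balS A mA) -[RHS]/(load _ A) load_subdivision.
- suff -> : total_mass (subdivision x S) = total_mass S by [].
  elim: S {sysS balS minS} => //= s S IH.
  by rewrite /subdivision /= total_mass_cat total_mass_cons -IH total_mass_subdivide.
Qed.

(** * Force balance *)

Lemma point_mass1 (R : realType) (x a : plane R) :
  point_mass a [set x] = (a == x)%:R.
Proof.
have -> : (a == x) = (a \in [set x]) by apply/eqP/idP; rewrite inE.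
by rewrite /point_mass diracE.
Qed.

(** A beam charges a singleton only if it ends there, and its mass at an end is
    exactly the boundary force. *)
Lemma load_boundary_force (R : realType) (x : plane R) (S : seq (spring R)) :
  is_spring_system S ->
  load S [set x] = \sum_(s <- S | (end1 s == x) || (end2 s == x)) boundary_force x s.
Proof.
move=> sysS; rewrite [RHS]big_mkcond /=; apply: eq_big_seq => s sS.
have /andP[ab _] := allP sysS s sS.
rewrite /beam !point_mass1 /boundary_force /far_end.
have [e1x|_] := eqVneq (end1 s) x.
  by rewrite eq_sym -e1x (negbTE ab) /= sub0r scaleN1r -normalizeB.
have [->|_] := eqVneq (end2 s) x; first by rewrite subr0 scale1r.
by rewrite subrr scale0r scaler0.
Qed.

Lemma measurable_plane1 (R : realType) (x : plane R) :
  measurable ([set x] : set (borel_plane R)).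
Proof.
rewrite -[X in measurable X]setCK; apply: measurableC.
apply: sub_sigma_algebra; apply: closed_openC.
exact/(@accessible_closed_set1 (plane R))/hausdorff_accessible/norm_hausdorff.
Qed.

(** * Shortening an acute pair *)

(** A piece of a half-line from x in the direction e, with constant tension. *)
Definition rod (R : realType) (x e : plane R) (a b lam : R) : spring R :=
  (x + a *: e, x + b *: e, lam).

Lemma load_rod (R : realType) (x e : plane R) (a b lam : R) A :
  dot e e = 1 -> a <= b ->
  load [:: rod x e a b lam] A =
  (lam * (point_mass (x + b *: e) A - point_mass (x + a *: e) A)) *: e.
Proof.
move=> e1; rewrite /load big_seq1 /beam /end1 /end2 /coef /= le_eqVlt.
case/predU1P => [->|ab]; first by rewrite !subrr mulr0 !scale0r scaler0.
have -> : x + b *: e - (x + a *: e) = (b - a) *: e.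
  by rewrite opprD addrACA subrr add0r scalerBl.
rewrite normalizeZ ?subr_gt0 //.
by rewrite /normalize /enorm e1 sqrtr1 invr1 scale1r scalerA.
Qed.

Lemma total_mass_rod (R : realType) (x e : plane R) (a b lam : R) :
  dot e e = 1 -> a <= b ->
  total_mass [:: rod x e a b lam] = `|lam| * (b - a).
Proof.
move=> e1 ab; rewrite /total_mass big_seq1 /end1 /end2 /coef /=.
have -> : x + b *: e - (x + a *: e) = (b - a) *: e.
  by rewrite opprD addrACA subrr add0r scalerBl.
by rewrite enormZ /enorm e1 sqrtr1 mulr1 (@ger0_norm _ (b - a)) ?subr_ge0.
Qed.

(** A bar of a self-stress drawn in the frame of origin x and unit r.  The
    number k is a force per unit of length, so that the end forces
    [k *: (d2 - d1)] are polynomial in the coordinates. *)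
Definition strut (R : realType) (x : plane R) (r : R) (d1 d2 : plane R) (k : R) :
    spring R :=
  (x + r *: d1, x + r *: d2, k * enorm (d2 - d1)).

Lemma load_strut (R : realType) (x : plane R) (r : R) (d1 d2 : plane R) (k : R) A :
  0 < r ->
  load [:: strut x r d1 d2 k] A =
  (k * (point_mass (x + r *: d2) A - point_mass (x + r *: d1) A)) *: (d2 - d1).
Proof.
move=> r0; rewrite /load big_seq1 /beam /end1 /end2 /coef /=.
have -> : x + r *: d2 - (x + r *: d1) = r *: (d2 - d1).
  by rewrite opprD addrACA subrr add0r scalerBr.
rewrite normalizeZ // -[in RHS](enorm_normalize (d2 - d1)).
by rewrite !scalerA; congr (_ *: _); ring.
Qed.

Lemma total_mass_strut (R : realType) (x : plane R) (r : R) (d1 d2 : plane R)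
    (k : R) : 0 < r ->
  total_mass [:: strut x r d1 d2 k] = `|k| * r * dot (d2 - d1) (d2 - d1).
Proof.
move=> r0; rewrite /total_mass big_seq1 /end1 /end2 /coef /=.
have -> : x + r *: d2 - (x + r *: d1) = r *: (d2 - d1).
  by rewrite opprD addrACA subrr add0r scalerBr.
rewrite enormZ normrM (gtr0_norm r0) (ger0_norm (enorm_ge0 _)) -enorm_sqr; ring.
Qed.

(** The part of the modification that concerns the spring in direction e, of
    length a and tension lam.  On the initial segment of length r its tension
    is lowered, and the three struts carry to x the sideways forces which the
    cross bars exert at e and t e.  The strength of the self-stress is
    lam * q; the apex w is taken at distance of order t^2 from the spring,
    which makes the coefficients below polynomial and is close enough for the
    struts to weigh less than the tension saved. *)
Definition reroute (R : realType) (x e f : plane R) (r t a lam q : R) :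
    seq (spring R) :=
  let w := t *: e - t ^+ 2 *: (f - (2 * t) *: e) in
  [:: rod x e 0 (r * t) (lam * (1 - q * (t + t ^+ 3 - 2 * t ^+ 4)));
      rod x e (r * t) r (lam * (1 - q * (t - 2 * t ^+ 4)));
      rod x e r a lam;
      strut x r 0 w (lam * q * (1 - t));
      strut x r (t *: e) w (- (lam * q));
      strut x r e w (lam * q * t)].

(** The rerouted spring is in equilibrium at w and along e; the excess on the
    right is the load that the cross bars absorb. *)
Lemma load_reroute (R : realType) (x e f : plane R) (r t a lam q : R) A :
  dot e e = 1 -> 0 < r <= a -> 0 <= t <= 1 ->
  load (reroute x e f r t a lam q) A =
  load [:: rod x e 0 a lam] A +
  (lam * q * t ^+ 2) *:
    ((point_mass x A * (1 - t)) *: (e + f)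
     - point_mass (x + r *: e) A *: (e - t *: f)
     + point_mass (x + r *: (t *: e)) A *: (t *: e - f)).
Proof.
move=> e1 /andP[r0 ra] /andP[t0 t1].
have rt0 : 0 <= r * t by rewrite mulr_ge0 // ltW.
have rtr : r * t <= r by rewrite ler_piMr // ltW.
have a0 : 0 <= a by rewrite (le_trans (ltW r0)).
rewrite /reroute load_cons (load_cons (rod x e (r * t) r _)) (load_cons (rod x e r a _)).
rewrite (load_cons (strut x r 0 _ _)) (load_cons (strut x r (t *: e) _ _)).
rewrite !load_strut // !load_rod //.
rewrite scale0r scaler0 !addr0 subr0 -(scalerA r t e).
move: (point_mass x A) (point_mass (x + r *: e) A)
  (point_mass (x + r *: (t *: e)) A) (point_mass (x + a *: e) A)
  (point_mass (x + r *: (t *: e - _)) A) => mx me mt ma mw.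
apply/rowP => i; rewrite !mxE.
by move: (e 0 i) (f 0 i) => ei fi; ring.
Qed.

(** The bounds on t and q keep the signs of the lowered tensions, so that the
    mass is an affine function of the strength of the self-stress. *)
Lemma total_mass_reroute (R : realType) (x e f : plane R) (r t a lam q : R) :
  dot e e = 1 -> dot f f = 1 -> dot e f = 2 * t -> 0 < r <= a ->
  0 <= t <= 2^-1 -> 0 <= q <= 1 ->
  total_mass (reroute x e f r t a lam q) =
  `|lam| * (a + q * r * (- t ^+ 2 + 3 * t ^+ 4 - 8 * t ^+ 6)).
Proof.
move=> e1 f1 ef /andP[r0 ra] /andP[t0 t1] /andP[q0 q1].
have rt0 : 0 <= r * t by rewrite mulr_ge0 // ltW.
have rtr : r * t <= r by rewrite ler_piMr ?ltW //; lra.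
rewrite /reroute total_mass_cons (total_mass_cons (rod x e (r * t) r _)).
rewrite (total_mass_cons (rod x e r a _)) (total_mass_cons (strut x r 0 _ _)).
rewrite (total_mass_cons (strut x r (t *: e) _ _)) !total_mass_strut //.
rewrite !total_mass_rod //.
have t3 : 0 <= t ^+ 3 <= 4^-1 * t.
  by rewrite exprS; have := mulr_ge0 t0 t0; rewrite -expr2 => ?; nra.
have t4 : 0 <= t ^+ 4 <= 8^-1 * t.
  by rewrite exprS; case/andP: t3 => ? ?; nra.
rewrite !normrM normrN normrM (ger0_norm q0) (ger0_norm t0).
rewrite (@ger0_norm _ (1 - t)); last by lra.
rewrite (@ger0_norm _ (1 - q * (t + _ - _))); last first.
  by rewrite subr_ge0 mulr_ile1 //; lra.
rewrite (@ger0_norm _ (1 - q * (t - _))); last first.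
  by rewrite subr_ge0 mulr_ile1 //; lra.
set w := t *: e - _.
have -> : w - 0 = (t + 2 * t ^+ 3) *: e + (- t ^+ 2) *: f.
  by apply/rowP => i; rewrite !mxE; move: (e 0 i) (f 0 i) => ei fi; ring.
have -> : w - t *: e = (2 * t ^+ 3) *: e + (- t ^+ 2) *: f.
  by apply/rowP => i; rewrite !mxE; move: (e 0 i) (f 0 i) => ei fi; ring.
have -> : w - e = (t + 2 * t ^+ 3 - 1) *: e + (- t ^+ 2) *: f.
  by apply/rowP => i; rewrite !mxE; move: (e 0 i) (f 0 i) => ei fi; ring.
rewrite !dot_comb // ef; move: `|lam| => n; ring.
Qed.

(** The excess loads of the two rerouted springs have opposite strengths k and
    - k; the excesses at x cancel, and two cross bars cancel the others. *)
Lemma acute_pair_improvable (R : realType) (x e f : plane R) (a b lam mu : R) :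
  dot e e = 1 -> dot f f = 1 -> 0 < dot e f -> 0 < a -> 0 < b ->
  0 < lam -> mu < 0 ->
  exists2 T : seq (spring R),
    forall A, load T A = load [:: rod x e 0 a lam; rod x f 0 b mu] A &
    total_mass T < total_mass [:: rod x e 0 a lam; rod x f 0 b mu].
Proof.
move=> e1 f1 ef0 a0 b0 lam0 mu0.
(* Neither tension may change sign, nor may the self-stress leave the springs. *)
pose t := dot e f / 2; pose k := Num.min lam (- mu); pose r := Num.min a b.
have ef : dot e f = 2 * t by rewrite /t; field.
have fe : dot f e = 2 * t by rewrite dotC.
have cross_e : t *: f - e = (- 1) *: e + t *: f by rewrite scaleN1r addrC.
have cross_f : f - t *: e = (- t) *: e + 1 *: f by rewrite scaleNr scale1r addrC.
have t0 : 0 < t by rewrite divr_gt0.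
have t1 : t <= 2^-1.
  (* the Cauchy-Schwarz inequality for unit vectors *)
  by have := dot_ge0 (1 *: e + (- 1) *: f); rewrite dot_comb // ef; lra.
have r0 : 0 < r by rewrite lt_min a0.
have k0 : 0 < k by rewrite lt_min lam0 oppr_gt0.
have ra : 0 < r <= a by rewrite r0 ge_min lexx.
have rb : 0 < r <= b by rewrite r0 ge_min lexx orbT.
have tI : 0 <= t <= 1 by rewrite ltW //=; lra.
have tH : 0 <= t <= 2^-1 by rewrite ltW.
have nmu0 : 0 < - mu by rewrite oppr_gt0.
have lamk : lam * (k / lam) = k by rewrite mulrC divfK ?gt_eqF.
have muk : mu * (k / - mu) = - k by rewrite invrN mulrN mulrN mulrC divfK ?lt_eqF.
have qlam : 0 <= k / lam <= 1.
  by rewrite (divr_ge0 (ltW k0) (ltW lam0)) /= ler_pdivrMr // mul1r ge_min lexx.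
have qmu : 0 <= k / - mu <= 1.
  by rewrite (divr_ge0 (ltW k0) (ltW nmu0)) /= ler_pdivrMr // mul1r ge_min lexx orbT.
pose cross := [:: strut x r e (t *: f) (k * t ^+ 2);
                  strut x r (t *: e) f (- (k * t ^+ 2))].
exists (reroute x e f r t a lam (k / lam) ++ reroute x f e r t b mu (k / - mu) ++ cross).
  move=> A; rewrite !load_cat !load_reroute //.
  rewrite (load_cons (strut _ _ _ _ _)) [in RHS]load_cons lamk muk !load_strut //.
  move: (load _ A) (load _ A) (point_mass _ A) (point_mass _ A)
    (point_mass _ A) (point_mass _ A) (point_mass _ A) => L1 L2 m1 m2 m3 m4 m5.
  apply/rowP => i; rewrite !mxE.
  by move: (L1 0 i) (L2 0 i) (e 0 i) (f 0 i) => l1 l2 ei fi; ring.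
rewrite !total_mass_cat !total_mass_reroute //.
rewrite (total_mass_cons (strut _ _ _ _ _)) [ltRHS]total_mass_cons !total_mass_rod ?ltW // !total_mass_strut //.
rewrite normrN (ger0_norm (mulr_ge0 (ltW k0) (sqr_ge0 t))) (gtr0_norm lam0) (ltr0_norm mu0).
rewrite cross_e cross_f !dot_comb // ef -subr_gt0.
set lhs := (X in 0 < X).
suff -> : lhs = k * r * (16 * t ^+ 6).
  by rewrite !mulr_gt0 ?exprn_gt0.
have split_mass n d q P : n * q = k -> n * (d + q * r * P) = n * d + k * r * P.
  by move=> <-; ring.
rewrite /lhs !split_mass ?mulNr ?muk ?opprK //; ring.
Qed.

(** * Springs ending at a common point *)

Definition direction (R : realType) (x : plane R) (s : spring R) : plane R :=
  normalize (far_end x s - x).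

Definition at_end (R : realType) (x : plane R) (s : spring R) : bool :=
  (end1 s == x) || (end2 s == x).

Lemma far_end_neq (R : realType) (x : plane R) (s : spring R) :
  is_spring s -> at_end x s -> far_end x s - x != 0.
Proof.
rewrite subr_eq0 /at_end /far_end => /andP[ab _].
by have [<- _|] := eqVneq (end1 s) x; rewrite // eq_sym.
Qed.

Lemma rod_far_end (R : realType) (x : plane R) (s : spring R) :
  rod x (direction x s) 0 (enorm (far_end x s - x)) (coef s) =
  (x, far_end x s, coef s).
Proof.
by rewrite /rod scale0r addr0 enorm_normalize addrC subrK.
Qed.

Lemma load_far_end (R : realType) (x : plane R) (s : spring R) A :
  at_end x s -> load [:: (x, far_end x s, coef s)] A = load [:: s] A.
Proof.
rewrite /load !big_seq1 /at_end /far_end /beam; case: eqP => [<- //|_] /= /eqP <-.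
rewrite /end1 /end2 /coef /= normalizeB scalerN -scaleNr opprB //.
Qed.

Lemma total_mass_far_end (R : realType) (x : plane R) (s : spring R) :
  at_end x s -> total_mass [:: (x, far_end x s, coef s)] = total_mass [:: s].
Proof.
rewrite /total_mass !big_seq1 /at_end /far_end; case: eqP => [<- //|_] /= /eqP <-.
by rewrite /end1 /end2 /coef /= -opprB -scaleN1r enormZ normrN1 mul1r.
Qed.

(** Otherwise the pair could be replaced by a lighter list with the same load. *)
Lemma minimizer_obtuse (R : realType) (mu : vmeasure R) (S : seq (spring R))
    (x : plane R) (s t : spring R) :
  minimizer mu S -> s \in S -> t \in S -> at_end x s -> at_end x t ->
  stretched s -> compressed t -> dot (direction x s) (direction x t) <= 0.
Proof.
move=> minS sS tS sx tx s0 t0; rewrite leNgt; apply/negP => acute.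
have [sysS _ _] := minS.
have sd := far_end_neq (allP sysS s sS) sx.
have td := far_end_neq (allP sysS t tS) tx.
have ts : t != s.
  by apply: contraTneq t0 => ->; rewrite /compressed -leNgt ltW.
have Sst : perm_eq S (s :: t :: rem t (rem s S)).
  apply: perm_trans (perm_to_rem sS) _; rewrite perm_cons perm_to_rem //.
  by move: tS; rewrite (perm_mem (perm_to_rem sS)) inE (negbTE ts).
have := acute_pair_improvable x (dot_normalize sd) (dot_normalize td) acute.
case/(_ (enorm (far_end x s - x)) (enorm (far_end x t - x)) (coef s) (coef t)).
- by rewrite enorm_gt0.
- by rewrite enorm_gt0.
- by [].
- by [].
move=> T; rewrite !rod_far_end => loadT massT.
have : total_mass S <= total_mass (T ++ rem t (rem s S)).
  apply: (minimizer_le minS) => A; rewrite load_cat loadT.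
  rewrite load_cons !load_far_end // -load_cat -(load_cat [:: s; t]).
  exact/esym/perm_big.
have -> : total_mass S = total_mass [:: s; t] + total_mass (rem t (rem s S)).
  by rewrite -(total_mass_cat [:: s; t]); exact: perm_big.
rewrite total_mass_cat lerD2r leNgt => /negP; apply.
by move: massT; rewrite total_mass_cons !total_mass_far_end // -total_mass_cons.
Qed.

(** Obtuse pairs of opposite signs cannot balance unless they are orthogonal:
    the positive part P of the sum satisfies |P|^2 <= 0, and then each nonpositive
    term of the null inner product of P with [d j] vanishes. *)
Lemma balanced_obtuse_orthogonal (R : realType) (I : eqType) (r : seq I)
    (c : I -> R) (d : I -> plane R) :
  \sum_(i <- r) c i *: d i = 0 ->
  (forall i j, i \in r -> j \in r -> 0 < c i -> c j < 0 -> dot (d i) (d j) <= 0) ->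
  forall i j, i \in r -> j \in r -> 0 < c i -> c j < 0 -> dot (d i) (d j) = 0.
Proof.
rewrite (bigID (fun i => 0 < c i)) /=.
set P := \sum_(i <- r | 0 < c i) _; set Q := \sum_(i <- r | _) _ => PQ obtuse.
have P_obtuse j : j \in r -> c j < 0 -> dot (d j) P <= 0.
  move=> jr cj; rewrite dot_sumr big_seq_cond sumr_le0 // => i /andP[ir ci].
  by rewrite dotZr dotC mulr_ge0_le0 ?obtuse // ltW.
have P0 : P = 0.
  apply/eqP; rewrite -dot_eq0 eq_le dot_ge0 andbT.
  have -> : dot P P = - dot P Q.
    have -> : Q = (- 1) *: P by rewrite scaleN1r -[LHS](addKr P) PQ addr0.
    by rewrite dotZr mulN1r opprK.
  rewrite oppr_le0 dot_sumr big_seq_cond sumr_ge0 // => j /andP[jr].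
  rewrite -leNgt le_eqVlt dotZr => /predU1P[->|cj]; first by rewrite mul0r.
  by rewrite dotC mulr_le0 ?P_obtuse // ltW.
move=> i j ir jr ci cj.
have : dot (d j) P == 0 by rewrite P0 -(scale0r 0) dotZr mul0r.
rewrite dot_sumr big_seq_cond -oppr_eq0 -sumrN psumr_eq0; last first.
  move=> k /andP[kr ck].
  by rewrite oppr_ge0 dotZr dotC mulr_ge0_le0 ?obtuse // ltW.
move=> /allP /(_ i ir) /=; rewrite ir ci /= oppr_eq0 dotZr mulf_eq0 gt_eqF //=.
by rewrite dotC => /eqP.
Qed.

Theorem proposition4 (R : realType) (l : nat) (F M : 'I_l -> plane R)
    (S : seq (spring R)) (x : plane R) :
  equilibrium F M ->
  minimizer (force_system F M) S ->
  (forall i : 'I_l, x <> M i) ->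
  finite_set [set` springs_at S x] ->
  \sum_(s <- springs_at S x) boundary_force x s = 0 /\
  (forall s t : spring R, s \in springs_at S x -> t \in springs_at S x ->
     stretched s -> compressed t -> spring_angle x s t = pi / 2).
Proof.
move=> _ minS xM _; have minS' := minimizer_subdivision x minS.
have [sysS' balS' _] := minS'.
have bal0 : \sum_(s <- springs_at S x) boundary_force x s = 0.
  rewrite big_filter -load_boundary_force //.
  rewrite -[LHS](balS' _ (measurable_plane1 x)) /force_system big1 // => i _.
  by rewrite point_mass1 (introF eqP) ?scale0r // => Mx; apply: (xM i).
split=> // s t sx tx s0 t0.
have in_S' u : u \in springs_at S x -> u \in subdivision x S /\ at_end x u.
  by rewrite mem_filter => /andP[].
have orth : dot (direction x s) (direction x t) = 0.
  apply: (balanced_obtuse_orthogonal (r := springs_at S x) (c := @coef R)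
    (d := direction x)) => //.
    move/(congr1 -%R): bal0; rewrite oppr0 -sumrN; apply: etrans.
    apply: eq_bigr => u _; by rewrite /boundary_force normalizeB scalerN opprK.
  move=> u v /in_S'[uS ux] /in_S'[vS vx]; exact: minimizer_obtuse minS' _ _ _ _.
move: orth; rewrite /direction dotZl dotZr /spring_angle /angle => /eqP.
have [sS' sx'] := in_S' _ sx; have [tS' tx'] := in_S' _ tx.
rewrite !mulf_eq0 !invr_eq0 !enorm_eq0.
rewrite (negbTE (far_end_neq (allP sysS' s sS') sx')).
rewrite (negbTE (far_end_neq (allP sysS' t tS') tx')) /= => /eqP ->.
by rewrite mul0r acos0.
Qed.
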